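(* There exist quadratic polynomials $$Q_i(x)=X_{i,2}\, x^2+X_{i,1}\, x+X_{i,0},\qquad 0\le i\le 3,$$ where each $X_{i,j}$ is the explicit polynomial in the twelve variables $a_0,a_1,a_2,b_0,b_1,b_2,c_0,c_1,c_2,d_0,d_1,d_2$ given in the context, having the following property. If a point $$(c_0,c_1,c_2,a_0,a_1,a_2;\ b_0,b_1,b_2,d_0,d_1,d_2;\ z_0,z_1,z_2,z_3)\in\mathbb{R}^6\times\mathbb{R}^6\times\mathbb{R}^4$$ satisfies the six equations $$a_i=b_j z_j^2+b_k z_k^2-2d_i z_j z_k,\qquad c_i=z_3^2+b_i z_i^2-2z_i z_3\qquad (i=0,1,2),$$ where $j,k\in\{0,1,2\}$ are determined by $j\equiv i+1 \pmod 3$ and $k\equiv j+1\pmod 3$, then for every $i\in\{0,1,2,3\}$ evaluating $Q_i(z_i^2)$ on the coordinates of this point gives $0$, i.e. $$X_{i,2}\,z_i^4+X_{i,1}\,z_i^2+X_{i,0}=0 .$$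
   Context: The polynomials $X_{0,0},X_{0,1},X_{0,2},X_{3,0},X_{3,1},X_{3,2}$ are written below as X00, X01, X02, X30, X31, X32 in plain text: the symbols c0, a1, b2, d0, etc. stand for the variables $c_0,a_1,b_2,d_0$, etc.; juxtaposition means multiplication; and a caret means exponentiation of the single variable preceding it (so 2c0a0a2b1d0d1 is $2c_0a_0a_2b_1d_0d_1$ and c0^2a0b1d0d1 is $c_0^2a_0b_1d_0d_1$). Line breaks inside one formula have no meaning. \begin{verbatim} X00 = c0^2a0b1d0d1-2c0c1a0b1d0d1+c1^2a0b1d0d1+c0^2a1b1d0d1-2c0c1a1b1d0d1+c1^2a1b1d0d1-c0^2a2b1d0d1+2c0c1a2b1d0d1-c1^2a2b1d0d1 +2c0a0a2b1d0d1-2c1a0a2b1d0d1+2c0a1a2b1d0d1-2c1a1a2b1d0d1-2c0a2^2b1d0d1+2c1a2^2b1d0d1+a0a2^2b1d0d1+a1a2^2b1d0d1-a2^3b1d0d1 -c0^2a0b1b2d2+2c0c1a0b1b2d2-c1^2a0b1b2d2-c0a0^2b1b2d2+c1a0^2b1b2d2+c0^2a1b1b2d2-2c0c1a1b1b2d2+c1^2a1b1b2d2+2c0a0a1b1b2d2 -2c1a0a1b1b2d2-c0a1^2b1b2d2+c1a1^2b1b2d2+c0^2a2b1b2d2-2c0c1a2b1b2d2+c1^2a2b1b2d2-a0^2a2b1b2d2+2a0a1a2b1b2d2-a1^2a2b1b2d2 +c0a2^2b1b2d2-c1a2^2b1b2d2+a0a2^2b1b2d2-a1a2^2b1b2d2-2c0^2a1d0^2d2+4c0c1a1d0^2d2-2c1^2a1d0^2d2+2a1a2^2d0^2d2-c0a0^2b1b2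 -c1a0^2b1b2+2c0a0a1b1b2+2c1a0a1b1b2-c0a1^2b1b2-c1a1^2b1b2+2c0a0a2b1b2+2c1a0a2b1b2+a0^2a2b1b2-2c0a1a2b1b2-2c1a1a2b1b2 -2a0a1a2b1b2+a1^2a2b1b2-c0a2^2b1b2-c1a2^2b1b2-2a0a2^2b1b2+2a1a2^2b1b2+a2^3b1b2+4c0a1a2d0^2+4c1a1a2d0^2-4a1a2^2d0^2 -4c0a0a2d0d1-4c0a1a2d0d1+4c0a2^2d0d1+2c0a0^2b2d2-4c0a0a1b2d2+2c0a1^2b2d2-2c0a2^2b2d2 X01 = -4c0a0b0b1d0d1+4c1a0b0b1d0d1-4c0a1b0b1d0d1+4c1a1b0b1d0d1+4c0a2b0b1d0d1-4c1a2b0b1d0d1-4a0a2b0b1d0d1-4a1a2b0b1d0d1+4a2^2b0b1d0d1 -2c0^2b0b1b2d2+4c0c1b0b1b2d2-2c1^2b0b1b2d2+2a0^2b0b1b2d2-4a0a1b0b1b2d2+2a1^2b0b1b2d2-4c0a2b0b1b2d2+4c1a2b0b1b2d2-4a0a2b0b1b2d2 +4a1a2b0b1b2d2+2c0^2b0d0^2d2-4c0c1b0d0^2d2+2c1^2b0d0^2d2+4c0a1b0d0^2d2-4c1a1b0d0^2d2-4a1a2b0d0^2d2-2a2^2b0d0^2d2+2c0^2b1d1^2d2 -4c0c1b1d1^2d2+2c1^2b1d1^2d2+4c0a0b1d1^2d2-4c1a0b1d1^2d2+4a0a2b1d1^2d2-2a2^2b1d1^2d2-4c0^2d0d1d2^2+8c0c1d0d1d2^2-4c1^2d0d1d2^2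 +4a0a2d0d1d2^2+4a1a2d0d1d2^2+2c0^2b2d2^3-4c0c1b2d2^3+2c1^2b2d2^3-2a0^2b2d2^3+4a0a1b2d2^3-2a1^2b2d2^3-4c0a0b0b1b2-4c1a0b0b1b2 +4c0a1b0b1b2+4c1a1b0b1b2+4c0a2b0b1b2+4c1a2b0b1b2+4a0a2b0b1b2-4a1a2b0b1b2-4a2^2b0b1b2-4c0a1b0d0^2-4c1a1b0d0^2-4c0a2b0d0^2 -4c1a2b0d0^2+4a1a2b0d0^2+4a2^2b0d0^2+4c0a0b0d0d1+4c0a1b0d0d1-4c0a2b0d0d1+4a0a2b0d0d1+4a1a2b0d0d1-4a2^2b0d0d1-4c1a0b1d0d1 -4c1a1b1d0d1+4c1a2b1d0d1+4a0a2b1d0d1+4a1a2b1d0d1-4a2^2b1d0d1+4c0a0b1d1^2+4c1a0b1d1^2-4c0a2b1d1^2-4c1a2b1d1^2-4a0a2b1d1^2 +4a2^2b1d1^2+4c0a0b0b2d2-2a0^2b0b2d2-4c0a1b0b2d2+4a0a1b0b2d2-2a1^2b0b2d2+4c0a2b0b2d2+2a2^2b0b2d2+4c1a0b1b2d2-2a0^2b1b2d2 -4c1a1b1b2d2+4a0a1b1b2d2-2a1^2b1b2d2-4c1a2b1b2d2+2a2^2b1b2d2+8c1a1d0^2d2+8c0a2d0d1d2+8c1a2d0d1d2-8a0a2d0d1d2-8a1a2d0d1d2 -8c0a0d1^2d2+4a0^2b2d2^2-8a0a1b2d2^2+4a1^2b2d2^2-4c0a2b2d2^2-4c1a2b2d2^2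 X02 = 4a0b0^2b1d0d1+4a1b0^2b1d0d1-4a2b0^2b1d0d1+4c0b0^2b1b2d2-4c1b0^2b1b2d2+4a0b0^2b1b2d2-4a1b0^2b1b2d2-4c0b0^2d0^2d2 +4c1b0^2d0^2d2+4a2b0^2d0^2d2-4c0b0b1d1^2d2+4c1b0b1d1^2d2-8a0b0b1d1^2d2+4a2b0b1d1^2d2+8c0b0d0d1d2^2-8c1b0d0d1d2^2-4a0b0d0d1d2^2 -4a1b0d0d1d2^2-4a2b0d0d1d2^2-4c0b0b2d2^3+4c1b0b2d2^3-4a0b0b2d2^3+4a1b0b2d2^3+8a0d1^2d2^3-4c0b0^2b1b2-4c1b0^2b1b2+4a2b0^2b1b2 +4c0b0^2d0^2+4c1b0^2d0^2-4a2b0^2d0^2-4a0b0^2d0d1-4a1b0^2d0d1+4a2b0^2d0d1-4a0b0b1d0d1-4a1b0b1d0d1+4a2b0b1d0d1+4c0b0b1d1^2 +4c1b0b1d1^2-4a2b0b1d1^2-4a0b0^2b2d2+4a1b0^2b2d2-4a2b0^2b2d2+8c1b0b1b2d2-4a0b0b1b2d2+4a1b0b1b2d2-4a2b0b1b2d2-8c1b0d0^2d2 -8c0b0d0d1d2-8c1b0d0d1d2+8a0b0d0d1d2+8a1b0d0d1d2+8a0b0d1^2d2-8c1b1d1^2d2+8a0b1d1^2d2+4c0b0b2d2^2+4c1b0b2d2^2+8a0b0b2d2^2 -8a1b0b2d2^2+4a2b0b2d2^2+16c1d0d1d2^2-16a0d1^2d2^2-8c1b2d2^3 X30 = c0^2c1b0b1b2+c0c1^2b0b1b2-c0^2c2b0b1b2+c1^2c2b0b1b2-c0c2^2b0b1b2-c1c2^2b0b1b2+c0^2a1b0b1b2-c1^2a1b0b1b2+2c0c2a1b0b1b2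 +2c1c2a1b0b1b2-c0a1^2b0b1b2-c1a1^2b0b1b2-c0^2a2b0b1b2-2c0c1a2b0b1b2-2c1c2a2b0b1b2+c2^2a2b0b1b2+2c1a1a2b0b1b2-2c2a1a2b0b1b2 +a1^2a2b0b1b2+c0a2^2b0b1b2+c2a2^2b0b1b2-a1a2^2b0b1b2-c0^3b0b1d1-2c0^2c1b0b1d1-c0c1^2b0b1d1+c0^2c2b0b1d1+2c0c1c2b0b1d1+c1^2c2b0b1d1 +c0^2a1b0b1d1+2c0c1a1b0b1d1+c1^2a1b0b1d1+2c0^2a2b0b1d1+2c0c1a2b0b1d1-2c0c2a2b0b1d1-2c1c2a2b0b1d1-2c0a1a2b0b1d1-2c1a1a2b0b1d1 -c0a2^2b0b1d1+c2a2^2b0b1d1+a1a2^2b0b1d1+2c0^2c2b1d1^2-2c1^2c2b1d1^2+4c1c2a2b1d1^2-2c2a2^2b1d1^2+c0^3b0b2d2-c0^2c1b0b2d2 +2c0^2c2b0b2d2-2c0c1c2b0b2d2+c0c2^2b0b2d2-c1c2^2b0b2d2-2c0^2a1b0b2d2+2c0c1a1b0b2d2-2c0c2a1b0b2d2+2c1c2a1b0b2d2+c0a1^2b0b2d2 -c1a1^2b0b2d2-c0^2a2b0b2d2-2c0c2a2b0b2d2-c2^2a2b0b2d2+2c0a1a2b0b2d2+2c2a1a2b0b2d2-a1^2a2b0b2d2-4c0^2c2d1^2d2+4c0c1c2d1^2d2 +4c0c2a2d1^2d2-2c0^2c1b2d2^2+2c1c2^2b2d2^2-4c1c2a1b2d2^2+2c1a1^2b2d2^2+4c0^2c1d1d2^2-4c0c1c2d1d2^2-4c0c1a1d1d2^2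 X31 = -4c0c1b0b1b2-2c1^2b0b1b2+4c0c2b0b1b2+2c2^2b0b1b2-4c0a1b0b1b2-4c2a1b0b1b2+2a1^2b0b1b2+4c0a2b0b1b2+4c1a2b0b1b2-2a2^2b0b1b2 +4c0^2b0b1d1+4c0c1b0b1d1-4c0c2b0b1d1-4c1c2b0b1d1-4c0a1b0b1d1-4c1a1b0b1d1-4c0a2b0b1d1+4c2a2b0b1d1+4a1a2b0b1d1-2c0^2b1d1^2 +2c1^2b1d1^2-4c0c2b1d1^2+4c1c2b1d1^2-4c1a2b1d1^2-4c2a2b1d1^2+2a2^2b1d1^2-4c0^2b0b2d2+4c0c1b0b2d2-4c0c2b0b2d2+4c1c2b0b2d2 +4c0a1b0b2d2-4c1a1b0b2d2+4c0a2b0b2d2+4c2a2b0b2d2-4a1a2b0b2d2+4c0^2d1^2d2-4c0c1d1^2d2+4c0c2d1^2d2-4c1c2d1^2d2-4c0a2d1^2d2 -4c2a2d1^2d2+2c0^2b2d2^2+4c0c1b2d2^2-4c1c2b2d2^2-2c2^2b2d2^2+4c1a1b2d2^2+4c2a1b2d2^2-2a1^2b2d2^2-4c0^2d1d2^2-4c0c1d1d2^2 +4c0c2d1d2^2+4c1c2d1d2^2+4c0a1d1d2^2+4c1a1d1d2^2-2c0^2b0b1+2c1^2b0b1+4c0a1b0b1+4c1a1b0b1-4c1a2b0b1-4a1a2b0b1+2a2^2b0b1 +2c0^2b0b2-2c2^2b0b2+4c2a1b0b2-2a1^2b0b2-4c0a2b0b2-4c2a2b0b2+4a1a2b0b2+2c1^2b1b2-2c2^2b1b2+4c2a1b1b2-2a1^2b1b2-4c1a2b1b2+2a2^2b1b2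 -4c0^2b0d1+4c0c2b0d1+4c0a1b0d1+4c0a2b0d1-4c2a2b0d1-4a1a2b0d1-4c1^2b1d1+4c0c2b1d1+4c0a1b1d1+8c1a2b1d1-4a2^2b1d1+8c2a2d1^2+4c0^2b0d2 -4c0c1b0d2-4c0a1b0d2+4c1a1b0d2-4c0a2b0d2+4a1a2b0d2-4c0c1b2d2+4c2^2b2d2-8c2a1b2d2+4a1^2b2d2-4c0a2b2d2+8c0c1d1d2-8c0c2d1d2 -8c0a1d1d2+8c0a2d1d2-8c1a1d2^2 X32 = 4c1b0b1b2-4c2b0b1b2+4a1b0b1b2-4a2b0b1b2-4c0b0b1d1+4c2b0b1d1+4a1b0b1d1+4c0b1d1^2-4c1b1d1^2+4a2b1d1^2+4c0b0b2d2-4c1b0b2d2 -4a2b0b2d2-4c0d1^2d2+4c1d1^2d2+4a2d1^2d2-4c0b2d2^2+4c2b2d2^2-4a1b2d2^2+4c0d1d2^2-4c2d1d2^2-4a1d1d2^2+4c0b0b1-4c1b0b1-8a1b0b1 +4a2b0b1-4c0b0b2+4c2b0b2-4a1b0b2+8a2b0b2-4c1b1b2+4c2b1b2-4a1b1b2+4a2b1b2+4c0b0d1-4c2b0d1-4a1b0d1-4c0b1d1+8c1b1d1-4c2b1d1-4a1b1d1 -8a2b1d1-8a2d1^2-4c0b0d2+4c1b0d2+4a2b0d2+4c0b2d2+4c1b2d2-8c2b2d2+8a1b2d2+4a2b2d2-8c1d1d2+8c2d1d2+8a1d1d2-8a2d1d2+8a1d2^2 +8a1b0-8a2b0+8a1b1-8a2b2+16a2d1-16a1d2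 \end{verbatim} For $j=0,1,2$, the polynomial $X_{1,j}$ is obtained from $X_{0,j}$ by swapping the indices $0$ and $1$ on every variable $a_\bullet,b_\bullet,c_\bullet,d_\bullet$ occurring in it, and $X_{2,j}$ is obtained from $X_{0,j}$ by swapping the indices $0$ and $2$ on every variable occurring in it. *)

(* Defs.v *)
From HB Require Import structures.
From mathcomp Require Import all_boot all_order all_fingroup all_algebra.
From mathcomp Require Import reals.
From mathcomp Require Export mpoly.

Set Implicit Arguments.
Unset Strict Implicit.
Unset Printing Implicit Defensive.

Import GRing.Theory.
Local Open Scope ring_scope.

(* The twelve variables are ordered c_0, c_1, c_2, a_0, a_1, a_2, b_0, b_1,    *)
(* b_2, d_0, d_1, d_2; this is the order of the entries of the row vector      *)
(* row_mx (row_mx c a) (row_mx b d), at which polynomials are evaluated.       *)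
Definition idx_c (i : 'I_3) : 'I_(3 + 3 + (3 + 3)) := lshift (3 + 3) (lshift 3 i).
Definition idx_a (i : 'I_3) : 'I_(3 + 3 + (3 + 3)) := lshift (3 + 3) (rshift 3 i).
Definition idx_b (i : 'I_3) : 'I_(3 + 3 + (3 + 3)) := rshift (3 + 3) (lshift 3 i).
Definition idx_d (i : 'I_3) : 'I_(3 + 3 + (3 + 3)) := rshift (3 + 3) (rshift 3 i).

Definition swap_idx (i j : 'I_3) : 'S_(3 + 3 + (3 + 3)) :=
  (tperm (idx_c i) (idx_c j) * tperm (idx_a i) (idx_a j)
   * tperm (idx_b i) (idx_b j) * tperm (idx_d i) (idx_d j))%g.

Section Coefficients.
Variable R : comNzRingType.

Local Notation c_ i := ('X_(idx_c i) : {mpoly R[3 + 3 + (3 + 3)]}).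
Local Notation a_ i := ('X_(idx_a i) : {mpoly R[3 + 3 + (3 + 3)]}).
Local Notation b_ i := ('X_(idx_b i) : {mpoly R[3 + 3 + (3 + 3)]}).
Local Notation d_ i := ('X_(idx_d i) : {mpoly R[3 + 3 + (3 + 3)]}).
Local Notation c0 := (c_ 0%R).
Local Notation c1 := (c_ 1%R).
Local Notation c2 := (c_ 2%R).
Local Notation a0 := (a_ 0%R).
Local Notation a1 := (a_ 1%R).
Local Notation a2 := (a_ 2%R).
Local Notation b0 := (b_ 0%R).
Local Notation b1 := (b_ 1%R).
Local Notation b2 := (b_ 2%R).
Local Notation d0 := (d_ 0%R).
Local Notation d1 := (d_ 1%R).
Local Notation d2 := (d_ 2%R).

Definition X00 : {mpoly R[3 + 3 + (3 + 3)]} :=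
  c0 ^+ 2 * a0 * b1 * d0 * d1 - 2 * c0 * c1 * a0 * b1 * d0 * d1
  + c1 ^+ 2 * a0 * b1 * d0 * d1 + c0 ^+ 2 * a1 * b1 * d0 * d1
  - 2 * c0 * c1 * a1 * b1 * d0 * d1 + c1 ^+ 2 * a1 * b1 * d0 * d1
  - c0 ^+ 2 * a2 * b1 * d0 * d1 + 2 * c0 * c1 * a2 * b1 * d0 * d1
  - c1 ^+ 2 * a2 * b1 * d0 * d1 + 2 * c0 * a0 * a2 * b1 * d0 * d1
  - 2 * c1 * a0 * a2 * b1 * d0 * d1 + 2 * c0 * a1 * a2 * b1 * d0 * d1
  - 2 * c1 * a1 * a2 * b1 * d0 * d1 - 2 * c0 * a2 ^+ 2 * b1 * d0 * d1
  + 2 * c1 * a2 ^+ 2 * b1 * d0 * d1 + a0 * a2 ^+ 2 * b1 * d0 * d1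
  + a1 * a2 ^+ 2 * b1 * d0 * d1 - a2 ^+ 3 * b1 * d0 * d1
  - c0 ^+ 2 * a0 * b1 * b2 * d2 + 2 * c0 * c1 * a0 * b1 * b2 * d2
  - c1 ^+ 2 * a0 * b1 * b2 * d2 - c0 * a0 ^+ 2 * b1 * b2 * d2
  + c1 * a0 ^+ 2 * b1 * b2 * d2 + c0 ^+ 2 * a1 * b1 * b2 * d2
  - 2 * c0 * c1 * a1 * b1 * b2 * d2 + c1 ^+ 2 * a1 * b1 * b2 * d2
  + 2 * c0 * a0 * a1 * b1 * b2 * d2 - 2 * c1 * a0 * a1 * b1 * b2 * d2
  - c0 * a1 ^+ 2 * b1 * b2 * d2 + c1 * a1 ^+ 2 * b1 * b2 * d2
  + c0 ^+ 2 * a2 * b1 * b2 * d2 - 2 * c0 * c1 * a2 * b1 * b2 * d2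
  + c1 ^+ 2 * a2 * b1 * b2 * d2 - a0 ^+ 2 * a2 * b1 * b2 * d2
  + 2 * a0 * a1 * a2 * b1 * b2 * d2 - a1 ^+ 2 * a2 * b1 * b2 * d2
  + c0 * a2 ^+ 2 * b1 * b2 * d2 - c1 * a2 ^+ 2 * b1 * b2 * d2
  + a0 * a2 ^+ 2 * b1 * b2 * d2 - a1 * a2 ^+ 2 * b1 * b2 * d2
  - 2 * c0 ^+ 2 * a1 * d0 ^+ 2 * d2 + 4 * c0 * c1 * a1 * d0 ^+ 2 * d2
  - 2 * c1 ^+ 2 * a1 * d0 ^+ 2 * d2 + 2 * a1 * a2 ^+ 2 * d0 ^+ 2 * d2
  - c0 * a0 ^+ 2 * b1 * b2 - c1 * a0 ^+ 2 * b1 * b2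
  + 2 * c0 * a0 * a1 * b1 * b2 + 2 * c1 * a0 * a1 * b1 * b2
  - c0 * a1 ^+ 2 * b1 * b2 - c1 * a1 ^+ 2 * b1 * b2
  + 2 * c0 * a0 * a2 * b1 * b2 + 2 * c1 * a0 * a2 * b1 * b2
  + a0 ^+ 2 * a2 * b1 * b2 - 2 * c0 * a1 * a2 * b1 * b2
  - 2 * c1 * a1 * a2 * b1 * b2 - 2 * a0 * a1 * a2 * b1 * b2
  + a1 ^+ 2 * a2 * b1 * b2 - c0 * a2 ^+ 2 * b1 * b2 - c1 * a2 ^+ 2 * b1 * b2
  - 2 * a0 * a2 ^+ 2 * b1 * b2 + 2 * a1 * a2 ^+ 2 * b1 * b2
  + a2 ^+ 3 * b1 * b2 + 4 * c0 * a1 * a2 * d0 ^+ 2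
  + 4 * c1 * a1 * a2 * d0 ^+ 2 - 4 * a1 * a2 ^+ 2 * d0 ^+ 2
  - 4 * c0 * a0 * a2 * d0 * d1 - 4 * c0 * a1 * a2 * d0 * d1
  + 4 * c0 * a2 ^+ 2 * d0 * d1 + 2 * c0 * a0 ^+ 2 * b2 * d2
  - 4 * c0 * a0 * a1 * b2 * d2 + 2 * c0 * a1 ^+ 2 * b2 * d2
  - 2 * c0 * a2 ^+ 2 * b2 * d2.

Definition X01 : {mpoly R[3 + 3 + (3 + 3)]} :=
  - 4 * c0 * a0 * b0 * b1 * d0 * d1 + 4 * c1 * a0 * b0 * b1 * d0 * d1
  - 4 * c0 * a1 * b0 * b1 * d0 * d1 + 4 * c1 * a1 * b0 * b1 * d0 * d1
  + 4 * c0 * a2 * b0 * b1 * d0 * d1 - 4 * c1 * a2 * b0 * b1 * d0 * d1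
  - 4 * a0 * a2 * b0 * b1 * d0 * d1 - 4 * a1 * a2 * b0 * b1 * d0 * d1
  + 4 * a2 ^+ 2 * b0 * b1 * d0 * d1 - 2 * c0 ^+ 2 * b0 * b1 * b2 * d2
  + 4 * c0 * c1 * b0 * b1 * b2 * d2 - 2 * c1 ^+ 2 * b0 * b1 * b2 * d2
  + 2 * a0 ^+ 2 * b0 * b1 * b2 * d2 - 4 * a0 * a1 * b0 * b1 * b2 * d2
  + 2 * a1 ^+ 2 * b0 * b1 * b2 * d2 - 4 * c0 * a2 * b0 * b1 * b2 * d2
  + 4 * c1 * a2 * b0 * b1 * b2 * d2 - 4 * a0 * a2 * b0 * b1 * b2 * d2
  + 4 * a1 * a2 * b0 * b1 * b2 * d2 + 2 * c0 ^+ 2 * b0 * d0 ^+ 2 * d2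
  - 4 * c0 * c1 * b0 * d0 ^+ 2 * d2 + 2 * c1 ^+ 2 * b0 * d0 ^+ 2 * d2
  + 4 * c0 * a1 * b0 * d0 ^+ 2 * d2 - 4 * c1 * a1 * b0 * d0 ^+ 2 * d2
  - 4 * a1 * a2 * b0 * d0 ^+ 2 * d2 - 2 * a2 ^+ 2 * b0 * d0 ^+ 2 * d2
  + 2 * c0 ^+ 2 * b1 * d1 ^+ 2 * d2 - 4 * c0 * c1 * b1 * d1 ^+ 2 * d2
  + 2 * c1 ^+ 2 * b1 * d1 ^+ 2 * d2 + 4 * c0 * a0 * b1 * d1 ^+ 2 * d2
  - 4 * c1 * a0 * b1 * d1 ^+ 2 * d2 + 4 * a0 * a2 * b1 * d1 ^+ 2 * d2
  - 2 * a2 ^+ 2 * b1 * d1 ^+ 2 * d2 - 4 * c0 ^+ 2 * d0 * d1 * d2 ^+ 2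
  + 8 * c0 * c1 * d0 * d1 * d2 ^+ 2 - 4 * c1 ^+ 2 * d0 * d1 * d2 ^+ 2
  + 4 * a0 * a2 * d0 * d1 * d2 ^+ 2 + 4 * a1 * a2 * d0 * d1 * d2 ^+ 2
  + 2 * c0 ^+ 2 * b2 * d2 ^+ 3 - 4 * c0 * c1 * b2 * d2 ^+ 3
  + 2 * c1 ^+ 2 * b2 * d2 ^+ 3 - 2 * a0 ^+ 2 * b2 * d2 ^+ 3
  + 4 * a0 * a1 * b2 * d2 ^+ 3 - 2 * a1 ^+ 2 * b2 * d2 ^+ 3
  - 4 * c0 * a0 * b0 * b1 * b2 - 4 * c1 * a0 * b0 * b1 * b2
  + 4 * c0 * a1 * b0 * b1 * b2 + 4 * c1 * a1 * b0 * b1 * b2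
  + 4 * c0 * a2 * b0 * b1 * b2 + 4 * c1 * a2 * b0 * b1 * b2
  + 4 * a0 * a2 * b0 * b1 * b2 - 4 * a1 * a2 * b0 * b1 * b2
  - 4 * a2 ^+ 2 * b0 * b1 * b2 - 4 * c0 * a1 * b0 * d0 ^+ 2
  - 4 * c1 * a1 * b0 * d0 ^+ 2 - 4 * c0 * a2 * b0 * d0 ^+ 2
  - 4 * c1 * a2 * b0 * d0 ^+ 2 + 4 * a1 * a2 * b0 * d0 ^+ 2
  + 4 * a2 ^+ 2 * b0 * d0 ^+ 2 + 4 * c0 * a0 * b0 * d0 * d1
  + 4 * c0 * a1 * b0 * d0 * d1 - 4 * c0 * a2 * b0 * d0 * d1
  + 4 * a0 * a2 * b0 * d0 * d1 + 4 * a1 * a2 * b0 * d0 * d1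
  - 4 * a2 ^+ 2 * b0 * d0 * d1 - 4 * c1 * a0 * b1 * d0 * d1
  - 4 * c1 * a1 * b1 * d0 * d1 + 4 * c1 * a2 * b1 * d0 * d1
  + 4 * a0 * a2 * b1 * d0 * d1 + 4 * a1 * a2 * b1 * d0 * d1
  - 4 * a2 ^+ 2 * b1 * d0 * d1 + 4 * c0 * a0 * b1 * d1 ^+ 2
  + 4 * c1 * a0 * b1 * d1 ^+ 2 - 4 * c0 * a2 * b1 * d1 ^+ 2
  - 4 * c1 * a2 * b1 * d1 ^+ 2 - 4 * a0 * a2 * b1 * d1 ^+ 2
  + 4 * a2 ^+ 2 * b1 * d1 ^+ 2 + 4 * c0 * a0 * b0 * b2 * d2
  - 2 * a0 ^+ 2 * b0 * b2 * d2 - 4 * c0 * a1 * b0 * b2 * d2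
  + 4 * a0 * a1 * b0 * b2 * d2 - 2 * a1 ^+ 2 * b0 * b2 * d2
  + 4 * c0 * a2 * b0 * b2 * d2 + 2 * a2 ^+ 2 * b0 * b2 * d2
  + 4 * c1 * a0 * b1 * b2 * d2 - 2 * a0 ^+ 2 * b1 * b2 * d2
  - 4 * c1 * a1 * b1 * b2 * d2 + 4 * a0 * a1 * b1 * b2 * d2
  - 2 * a1 ^+ 2 * b1 * b2 * d2 - 4 * c1 * a2 * b1 * b2 * d2
  + 2 * a2 ^+ 2 * b1 * b2 * d2 + 8 * c1 * a1 * d0 ^+ 2 * d2
  + 8 * c0 * a2 * d0 * d1 * d2 + 8 * c1 * a2 * d0 * d1 * d2
  - 8 * a0 * a2 * d0 * d1 * d2 - 8 * a1 * a2 * d0 * d1 * d2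
  - 8 * c0 * a0 * d1 ^+ 2 * d2 + 4 * a0 ^+ 2 * b2 * d2 ^+ 2
  - 8 * a0 * a1 * b2 * d2 ^+ 2 + 4 * a1 ^+ 2 * b2 * d2 ^+ 2
  - 4 * c0 * a2 * b2 * d2 ^+ 2 - 4 * c1 * a2 * b2 * d2 ^+ 2.

Definition X02 : {mpoly R[3 + 3 + (3 + 3)]} :=
  4 * a0 * b0 ^+ 2 * b1 * d0 * d1 + 4 * a1 * b0 ^+ 2 * b1 * d0 * d1
  - 4 * a2 * b0 ^+ 2 * b1 * d0 * d1 + 4 * c0 * b0 ^+ 2 * b1 * b2 * d2
  - 4 * c1 * b0 ^+ 2 * b1 * b2 * d2 + 4 * a0 * b0 ^+ 2 * b1 * b2 * d2
  - 4 * a1 * b0 ^+ 2 * b1 * b2 * d2 - 4 * c0 * b0 ^+ 2 * d0 ^+ 2 * d2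
  + 4 * c1 * b0 ^+ 2 * d0 ^+ 2 * d2 + 4 * a2 * b0 ^+ 2 * d0 ^+ 2 * d2
  - 4 * c0 * b0 * b1 * d1 ^+ 2 * d2 + 4 * c1 * b0 * b1 * d1 ^+ 2 * d2
  - 8 * a0 * b0 * b1 * d1 ^+ 2 * d2 + 4 * a2 * b0 * b1 * d1 ^+ 2 * d2
  + 8 * c0 * b0 * d0 * d1 * d2 ^+ 2 - 8 * c1 * b0 * d0 * d1 * d2 ^+ 2
  - 4 * a0 * b0 * d0 * d1 * d2 ^+ 2 - 4 * a1 * b0 * d0 * d1 * d2 ^+ 2
  - 4 * a2 * b0 * d0 * d1 * d2 ^+ 2 - 4 * c0 * b0 * b2 * d2 ^+ 3
  + 4 * c1 * b0 * b2 * d2 ^+ 3 - 4 * a0 * b0 * b2 * d2 ^+ 3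
  + 4 * a1 * b0 * b2 * d2 ^+ 3 + 8 * a0 * d1 ^+ 2 * d2 ^+ 3
  - 4 * c0 * b0 ^+ 2 * b1 * b2 - 4 * c1 * b0 ^+ 2 * b1 * b2
  + 4 * a2 * b0 ^+ 2 * b1 * b2 + 4 * c0 * b0 ^+ 2 * d0 ^+ 2
  + 4 * c1 * b0 ^+ 2 * d0 ^+ 2 - 4 * a2 * b0 ^+ 2 * d0 ^+ 2
  - 4 * a0 * b0 ^+ 2 * d0 * d1 - 4 * a1 * b0 ^+ 2 * d0 * d1
  + 4 * a2 * b0 ^+ 2 * d0 * d1 - 4 * a0 * b0 * b1 * d0 * d1
  - 4 * a1 * b0 * b1 * d0 * d1 + 4 * a2 * b0 * b1 * d0 * d1
  + 4 * c0 * b0 * b1 * d1 ^+ 2 + 4 * c1 * b0 * b1 * d1 ^+ 2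
  - 4 * a2 * b0 * b1 * d1 ^+ 2 - 4 * a0 * b0 ^+ 2 * b2 * d2
  + 4 * a1 * b0 ^+ 2 * b2 * d2 - 4 * a2 * b0 ^+ 2 * b2 * d2
  + 8 * c1 * b0 * b1 * b2 * d2 - 4 * a0 * b0 * b1 * b2 * d2
  + 4 * a1 * b0 * b1 * b2 * d2 - 4 * a2 * b0 * b1 * b2 * d2
  - 8 * c1 * b0 * d0 ^+ 2 * d2 - 8 * c0 * b0 * d0 * d1 * d2
  - 8 * c1 * b0 * d0 * d1 * d2 + 8 * a0 * b0 * d0 * d1 * d2
  + 8 * a1 * b0 * d0 * d1 * d2 + 8 * a0 * b0 * d1 ^+ 2 * d2
  - 8 * c1 * b1 * d1 ^+ 2 * d2 + 8 * a0 * b1 * d1 ^+ 2 * d2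
  + 4 * c0 * b0 * b2 * d2 ^+ 2 + 4 * c1 * b0 * b2 * d2 ^+ 2
  + 8 * a0 * b0 * b2 * d2 ^+ 2 - 8 * a1 * b0 * b2 * d2 ^+ 2
  + 4 * a2 * b0 * b2 * d2 ^+ 2 + 16 * c1 * d0 * d1 * d2 ^+ 2
  - 16 * a0 * d1 ^+ 2 * d2 ^+ 2 - 8 * c1 * b2 * d2 ^+ 3.

Definition X30 : {mpoly R[3 + 3 + (3 + 3)]} :=
  c0 ^+ 2 * c1 * b0 * b1 * b2 + c0 * c1 ^+ 2 * b0 * b1 * b2
  - c0 ^+ 2 * c2 * b0 * b1 * b2 + c1 ^+ 2 * c2 * b0 * b1 * b2
  - c0 * c2 ^+ 2 * b0 * b1 * b2 - c1 * c2 ^+ 2 * b0 * b1 * b2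
  + c0 ^+ 2 * a1 * b0 * b1 * b2 - c1 ^+ 2 * a1 * b0 * b1 * b2
  + 2 * c0 * c2 * a1 * b0 * b1 * b2 + 2 * c1 * c2 * a1 * b0 * b1 * b2
  - c0 * a1 ^+ 2 * b0 * b1 * b2 - c1 * a1 ^+ 2 * b0 * b1 * b2
  - c0 ^+ 2 * a2 * b0 * b1 * b2 - 2 * c0 * c1 * a2 * b0 * b1 * b2
  - 2 * c1 * c2 * a2 * b0 * b1 * b2 + c2 ^+ 2 * a2 * b0 * b1 * b2
  + 2 * c1 * a1 * a2 * b0 * b1 * b2 - 2 * c2 * a1 * a2 * b0 * b1 * b2
  + a1 ^+ 2 * a2 * b0 * b1 * b2 + c0 * a2 ^+ 2 * b0 * b1 * b2
  + c2 * a2 ^+ 2 * b0 * b1 * b2 - a1 * a2 ^+ 2 * b0 * b1 * b2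
  - c0 ^+ 3 * b0 * b1 * d1 - 2 * c0 ^+ 2 * c1 * b0 * b1 * d1
  - c0 * c1 ^+ 2 * b0 * b1 * d1 + c0 ^+ 2 * c2 * b0 * b1 * d1
  + 2 * c0 * c1 * c2 * b0 * b1 * d1 + c1 ^+ 2 * c2 * b0 * b1 * d1
  + c0 ^+ 2 * a1 * b0 * b1 * d1 + 2 * c0 * c1 * a1 * b0 * b1 * d1
  + c1 ^+ 2 * a1 * b0 * b1 * d1 + 2 * c0 ^+ 2 * a2 * b0 * b1 * d1
  + 2 * c0 * c1 * a2 * b0 * b1 * d1 - 2 * c0 * c2 * a2 * b0 * b1 * d1
  - 2 * c1 * c2 * a2 * b0 * b1 * d1 - 2 * c0 * a1 * a2 * b0 * b1 * d1
  - 2 * c1 * a1 * a2 * b0 * b1 * d1 - c0 * a2 ^+ 2 * b0 * b1 * d1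
  + c2 * a2 ^+ 2 * b0 * b1 * d1 + a1 * a2 ^+ 2 * b0 * b1 * d1
  + 2 * c0 ^+ 2 * c2 * b1 * d1 ^+ 2 - 2 * c1 ^+ 2 * c2 * b1 * d1 ^+ 2
  + 4 * c1 * c2 * a2 * b1 * d1 ^+ 2 - 2 * c2 * a2 ^+ 2 * b1 * d1 ^+ 2
  + c0 ^+ 3 * b0 * b2 * d2 - c0 ^+ 2 * c1 * b0 * b2 * d2
  + 2 * c0 ^+ 2 * c2 * b0 * b2 * d2 - 2 * c0 * c1 * c2 * b0 * b2 * d2
  + c0 * c2 ^+ 2 * b0 * b2 * d2 - c1 * c2 ^+ 2 * b0 * b2 * d2
  - 2 * c0 ^+ 2 * a1 * b0 * b2 * d2 + 2 * c0 * c1 * a1 * b0 * b2 * d2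
  - 2 * c0 * c2 * a1 * b0 * b2 * d2 + 2 * c1 * c2 * a1 * b0 * b2 * d2
  + c0 * a1 ^+ 2 * b0 * b2 * d2 - c1 * a1 ^+ 2 * b0 * b2 * d2
  - c0 ^+ 2 * a2 * b0 * b2 * d2 - 2 * c0 * c2 * a2 * b0 * b2 * d2
  - c2 ^+ 2 * a2 * b0 * b2 * d2 + 2 * c0 * a1 * a2 * b0 * b2 * d2
  + 2 * c2 * a1 * a2 * b0 * b2 * d2 - a1 ^+ 2 * a2 * b0 * b2 * d2
  - 4 * c0 ^+ 2 * c2 * d1 ^+ 2 * d2 + 4 * c0 * c1 * c2 * d1 ^+ 2 * d2
  + 4 * c0 * c2 * a2 * d1 ^+ 2 * d2 - 2 * c0 ^+ 2 * c1 * b2 * d2 ^+ 2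
  + 2 * c1 * c2 ^+ 2 * b2 * d2 ^+ 2 - 4 * c1 * c2 * a1 * b2 * d2 ^+ 2
  + 2 * c1 * a1 ^+ 2 * b2 * d2 ^+ 2 + 4 * c0 ^+ 2 * c1 * d1 * d2 ^+ 2
  - 4 * c0 * c1 * c2 * d1 * d2 ^+ 2 - 4 * c0 * c1 * a1 * d1 * d2 ^+ 2.

Definition X31 : {mpoly R[3 + 3 + (3 + 3)]} :=
  - 4 * c0 * c1 * b0 * b1 * b2 - 2 * c1 ^+ 2 * b0 * b1 * b2
  + 4 * c0 * c2 * b0 * b1 * b2 + 2 * c2 ^+ 2 * b0 * b1 * b2
  - 4 * c0 * a1 * b0 * b1 * b2 - 4 * c2 * a1 * b0 * b1 * b2
  + 2 * a1 ^+ 2 * b0 * b1 * b2 + 4 * c0 * a2 * b0 * b1 * b2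
  + 4 * c1 * a2 * b0 * b1 * b2 - 2 * a2 ^+ 2 * b0 * b1 * b2
  + 4 * c0 ^+ 2 * b0 * b1 * d1 + 4 * c0 * c1 * b0 * b1 * d1
  - 4 * c0 * c2 * b0 * b1 * d1 - 4 * c1 * c2 * b0 * b1 * d1
  - 4 * c0 * a1 * b0 * b1 * d1 - 4 * c1 * a1 * b0 * b1 * d1
  - 4 * c0 * a2 * b0 * b1 * d1 + 4 * c2 * a2 * b0 * b1 * d1
  + 4 * a1 * a2 * b0 * b1 * d1 - 2 * c0 ^+ 2 * b1 * d1 ^+ 2
  + 2 * c1 ^+ 2 * b1 * d1 ^+ 2 - 4 * c0 * c2 * b1 * d1 ^+ 2
  + 4 * c1 * c2 * b1 * d1 ^+ 2 - 4 * c1 * a2 * b1 * d1 ^+ 2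
  - 4 * c2 * a2 * b1 * d1 ^+ 2 + 2 * a2 ^+ 2 * b1 * d1 ^+ 2
  - 4 * c0 ^+ 2 * b0 * b2 * d2 + 4 * c0 * c1 * b0 * b2 * d2
  - 4 * c0 * c2 * b0 * b2 * d2 + 4 * c1 * c2 * b0 * b2 * d2
  + 4 * c0 * a1 * b0 * b2 * d2 - 4 * c1 * a1 * b0 * b2 * d2
  + 4 * c0 * a2 * b0 * b2 * d2 + 4 * c2 * a2 * b0 * b2 * d2
  - 4 * a1 * a2 * b0 * b2 * d2 + 4 * c0 ^+ 2 * d1 ^+ 2 * d2
  - 4 * c0 * c1 * d1 ^+ 2 * d2 + 4 * c0 * c2 * d1 ^+ 2 * d2
  - 4 * c1 * c2 * d1 ^+ 2 * d2 - 4 * c0 * a2 * d1 ^+ 2 * d2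
  - 4 * c2 * a2 * d1 ^+ 2 * d2 + 2 * c0 ^+ 2 * b2 * d2 ^+ 2
  + 4 * c0 * c1 * b2 * d2 ^+ 2 - 4 * c1 * c2 * b2 * d2 ^+ 2
  - 2 * c2 ^+ 2 * b2 * d2 ^+ 2 + 4 * c1 * a1 * b2 * d2 ^+ 2
  + 4 * c2 * a1 * b2 * d2 ^+ 2 - 2 * a1 ^+ 2 * b2 * d2 ^+ 2
  - 4 * c0 ^+ 2 * d1 * d2 ^+ 2 - 4 * c0 * c1 * d1 * d2 ^+ 2
  + 4 * c0 * c2 * d1 * d2 ^+ 2 + 4 * c1 * c2 * d1 * d2 ^+ 2
  + 4 * c0 * a1 * d1 * d2 ^+ 2 + 4 * c1 * a1 * d1 * d2 ^+ 2
  - 2 * c0 ^+ 2 * b0 * b1 + 2 * c1 ^+ 2 * b0 * b1 + 4 * c0 * a1 * b0 * b1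
  + 4 * c1 * a1 * b0 * b1 - 4 * c1 * a2 * b0 * b1 - 4 * a1 * a2 * b0 * b1
  + 2 * a2 ^+ 2 * b0 * b1 + 2 * c0 ^+ 2 * b0 * b2 - 2 * c2 ^+ 2 * b0 * b2
  + 4 * c2 * a1 * b0 * b2 - 2 * a1 ^+ 2 * b0 * b2 - 4 * c0 * a2 * b0 * b2
  - 4 * c2 * a2 * b0 * b2 + 4 * a1 * a2 * b0 * b2 + 2 * c1 ^+ 2 * b1 * b2
  - 2 * c2 ^+ 2 * b1 * b2 + 4 * c2 * a1 * b1 * b2 - 2 * a1 ^+ 2 * b1 * b2
  - 4 * c1 * a2 * b1 * b2 + 2 * a2 ^+ 2 * b1 * b2 - 4 * c0 ^+ 2 * b0 * d1
  + 4 * c0 * c2 * b0 * d1 + 4 * c0 * a1 * b0 * d1 + 4 * c0 * a2 * b0 * d1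
  - 4 * c2 * a2 * b0 * d1 - 4 * a1 * a2 * b0 * d1 - 4 * c1 ^+ 2 * b1 * d1
  + 4 * c0 * c2 * b1 * d1 + 4 * c0 * a1 * b1 * d1 + 8 * c1 * a2 * b1 * d1
  - 4 * a2 ^+ 2 * b1 * d1 + 8 * c2 * a2 * d1 ^+ 2 + 4 * c0 ^+ 2 * b0 * d2
  - 4 * c0 * c1 * b0 * d2 - 4 * c0 * a1 * b0 * d2 + 4 * c1 * a1 * b0 * d2
  - 4 * c0 * a2 * b0 * d2 + 4 * a1 * a2 * b0 * d2 - 4 * c0 * c1 * b2 * d2
  + 4 * c2 ^+ 2 * b2 * d2 - 8 * c2 * a1 * b2 * d2 + 4 * a1 ^+ 2 * b2 * d2
  - 4 * c0 * a2 * b2 * d2 + 8 * c0 * c1 * d1 * d2 - 8 * c0 * c2 * d1 * d2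
  - 8 * c0 * a1 * d1 * d2 + 8 * c0 * a2 * d1 * d2 - 8 * c1 * a1 * d2 ^+ 2.

Definition X32 : {mpoly R[3 + 3 + (3 + 3)]} :=
  4 * c1 * b0 * b1 * b2 - 4 * c2 * b0 * b1 * b2 + 4 * a1 * b0 * b1 * b2
  - 4 * a2 * b0 * b1 * b2 - 4 * c0 * b0 * b1 * d1 + 4 * c2 * b0 * b1 * d1
  + 4 * a1 * b0 * b1 * d1 + 4 * c0 * b1 * d1 ^+ 2 - 4 * c1 * b1 * d1 ^+ 2
  + 4 * a2 * b1 * d1 ^+ 2 + 4 * c0 * b0 * b2 * d2 - 4 * c1 * b0 * b2 * d2
  - 4 * a2 * b0 * b2 * d2 - 4 * c0 * d1 ^+ 2 * d2 + 4 * c1 * d1 ^+ 2 * d2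
  + 4 * a2 * d1 ^+ 2 * d2 - 4 * c0 * b2 * d2 ^+ 2 + 4 * c2 * b2 * d2 ^+ 2
  - 4 * a1 * b2 * d2 ^+ 2 + 4 * c0 * d1 * d2 ^+ 2 - 4 * c2 * d1 * d2 ^+ 2
  - 4 * a1 * d1 * d2 ^+ 2 + 4 * c0 * b0 * b1 - 4 * c1 * b0 * b1
  - 8 * a1 * b0 * b1 + 4 * a2 * b0 * b1 - 4 * c0 * b0 * b2 + 4 * c2 * b0 * b2
  - 4 * a1 * b0 * b2 + 8 * a2 * b0 * b2 - 4 * c1 * b1 * b2 + 4 * c2 * b1 * b2
  - 4 * a1 * b1 * b2 + 4 * a2 * b1 * b2 + 4 * c0 * b0 * d1 - 4 * c2 * b0 * d1
  - 4 * a1 * b0 * d1 - 4 * c0 * b1 * d1 + 8 * c1 * b1 * d1 - 4 * c2 * b1 * d1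
  - 4 * a1 * b1 * d1 - 8 * a2 * b1 * d1 - 8 * a2 * d1 ^+ 2 - 4 * c0 * b0 * d2
  + 4 * c1 * b0 * d2 + 4 * a2 * b0 * d2 + 4 * c0 * b2 * d2 + 4 * c1 * b2 * d2
  - 8 * c2 * b2 * d2 + 8 * a1 * b2 * d2 + 4 * a2 * b2 * d2 - 8 * c1 * d1 * d2
  + 8 * c2 * d1 * d2 + 8 * a1 * d1 * d2 - 8 * a2 * d1 * d2 + 8 * a1 * d2 ^+ 2
  + 8 * a1 * b0 - 8 * a2 * b0 + 8 * a1 * b1 - 8 * a2 * b2 + 16 * a2 * d1
  - 16 * a1 * d2.

Definition X (i : 'I_4) (j : 'I_3) : {mpoly R[3 + 3 + (3 + 3)]} :=
  let X0 := [:: X00; X01; X02]`_j in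
  let X3 := [:: X30; X31; X32]`_j in
  match val i with
  | 0 => X0
  | 1 => msym (swap_idx 0 1) X0
  | 2 => msym (swap_idx 0 2) X0
  | _ => X3
  end.

End Coefficients.

Arguments X R i j : clear implicits.

(* Main.v *)
Require Import Defs.
From mathcomp Require Import all_boot all_order all_fingroup all_algebra.
From mathcomp Require Import reals ring.
Import GRing.Theory Num.Theory.
Local Open Scope ring_scope.

(* Substituting the six equations turns the vanishing of Q_0(z_0^2) and of     *)
(* Q_3(z_3^2) into polynomial identities in the b_i, d_i, z_i.  The system is   *)
(* invariant under simultaneous permutations of the indices 0, 1, 2, so the     *)
(* vanishing for i = 1, 2 is the case i = 0 at the point with swapped indices.  *)

(** The two identities are [quadratic0_eq0] and [quadratic3_eq0]; [meval_msym] and [compatible_swap]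
    carry the first to the indices 1 and 2. That each polynomial is truly quadratic needs a nonzero
    leading coefficient: [X02_neq0] and [X32_neq0] evaluate at a 0-1 point to get 4 and 8, and
    [msym_neq0] transfers this to the swapped polynomials. *)

Lemma meval_msym (n : nat) (R : comNzRingType) (s : 'S_n) (v : 'I_n -> R)
    (p : {mpoly R[n]}) :
  meval v (msym s p) = meval (v \o s) p.
Proof.
rewrite /msym /mmap raddf_sum mevalE; apply: eq_bigr => m _ /=.
rewrite mevalM mevalC /mmap1 rmorph_prod; congr (_ * _).
by apply: eq_bigr => i _; rewrite rmorphXn /= mevalXU.
Qed.

Lemma msym_neq0 (n : nat) (R : comNzRingType) (s : 'S_n) (p : {mpoly R[n]}) :
  p != 0 -> msym s p != 0.
Proof.
apply: contra_neq => sp0; apply/mpolyP => m.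
(* Permuting variables permutes monomials bijectively, so every coefficient of [p] is one of
   [msym s p]. *)
have -> : m = [multinom [multinom m ((s^-1)%g i) | i < n] (s i) | i < n].
  by apply/mnmP => i; rewrite !mnmE permK.
by rewrite -mcoeff_sym sp0 !mcoeff0.
Qed.

Lemma size_quadratic (A : idomainType) (p q r : A) :
  p != 0 -> size (p *: 'X^2 + q *: 'X + r%:P) = 3.
Proof.
move=> p_neq0; have szp : size (p *: 'X^2) = 3 by rewrite size_scale ?size_polyXn.
rewrite -addrA size_polyDl szp //.
rewrite (leq_ltn_trans (size_polyD _ _)) // gtn_max.
rewrite (leq_ltn_trans (size_scale_leq _ _)) ?size_polyX //=.
by rewrite (leq_ltn_trans (size_polyC_leq1 _)).
Qed.

(** The four transpositions act on disjoint blocks of variables, so on each block only one of them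
    matters. *)
Lemma swap_idxE (i j k : 'I_3) :
  [/\ swap_idx i j (idx_c k) = idx_c (tperm i j k),
      swap_idx i j (idx_a k) = idx_a (tperm i j k),
      swap_idx i j (idx_b k) = idx_b (tperm i j k)
    & swap_idx i j (idx_d k) = idx_d (tperm i j k)].
Proof.
pose simp := (inj_eq (@lshift_inj _ _), inj_eq (@rshift_inj _ _), eq_lrshift,
  eq_rlshift, eqxx).
rewrite /idx_c /idx_a /idx_b /idx_d.
case: tpermP => [->|->|/eqP/negPf ki /eqP/negPf kj];
  case: (eqVneq j i) => [->|/negPf ji]; split;
  by rewrite !permM !permE /= ?simp ?ki ?kj ?ji /= ?simp ?ki ?kj ?ji /= ?simp.
Qed.

Section Compatible.
Variable R : comNzRingType.
Implicit Types (v : 'I_(3 + 3 + (3 + 3)) -> R) (y : 'I_3 -> R) (t : R).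

(* With y = (z_0, z_1, z_2) and t = z_3.  Quantifying over all orderings of the *)
(* three indices is harmless since the equation for a_i is symmetric in j, k.   *)
Definition compatible v y t : Prop :=
  forall i j k : 'I_3, uniq [:: i; j; k] ->
    v (idx_a i) = v (idx_b j) * y j ^+ 2 + v (idx_b k) * y k ^+ 2
                  - 2 * v (idx_d i) * y j * y k
    /\ v (idx_c i) = t ^+ 2 + v (idx_b i) * y i ^+ 2 - 2 * y i * t.

(** A transposition reverses the cyclic order of the indices, but it keeps them distinct, which is
    all that [compatible] asks. *)
Lemma compatible_swap i j v y t :
  compatible v y t -> compatible (v \o swap_idx i j) (y \o tperm i j) t.
Proof.
move=> vyt k l m klm /=.
have [-> -> -> ->] := swap_idxE i j k.
have [_ _ -> _] := swap_idxE i j l; have [_ _ -> _] := swap_idxE i j m.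
by apply: vyt; rewrite -(map_inj_uniq (@perm_inj _ (tperm i j))) in klm.
Qed.

Lemma quadratic0_eq0 v y t : compatible v y t ->
  meval v (X02 R) * (y 0 ^+ 2) ^+ 2 + meval v (X01 R) * y 0 ^+ 2
    + meval v (X00 R) = 0.
Proof.
move=> vyt.
have [a0 c0] := vyt 0 1 2 isT; have [a1 c1] := vyt 1 2 0 isT.
have [a2 c2] := vyt 2 0 1 isT.
(* In this form the equations match the atoms that [ring] meets after pushing [meval v] down to the
   variables; it then eliminates the [a_i] and [c_i]. *)
rewrite -!(mevalXU v) in a0 a1 a2 c0 c1 c2.
rewrite /X02 /X01 /X00; ring: a0 a1 a2 c0 c1 c2.
Qed.

Lemma quadratic3_eq0 v y t : compatible v y t ->
  meval v (X32 R) * (t ^+ 2) ^+ 2 + meval v (X31 R) * t ^+ 2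
    + meval v (X30 R) = 0.
Proof.
move=> vyt.
have [a0 c0] := vyt 0 1 2 isT; have [a1 c1] := vyt 1 2 0 isT.
have [a2 c2] := vyt 2 0 1 isT.
rewrite -!(mevalXU v) in a0 a1 a2 c0 c1 c2.
rewrite /X32 /X31 /X30; ring: a0 a1 a2 c0 c1 c2.
Qed.

End Compatible.

Section Nonzero.
Variable R : numDomainType.

(* The only monomial of X02 in the variables c_0, b_0, d_0 is 4 c_0 b_0^2 d_0^2. *)
Lemma X02_neq0 : X02 R != 0.
Proof.
pose v l : R := (l \in [:: idx_c 0; idx_b 0; idx_d 0])%:R.
have [c0 [c1 c2]] : v (idx_c 0) = 1 /\ v (idx_c 1) = 0 /\ v (idx_c 2) = 0 by [].
have [a0 [a1 a2]] : v (idx_a 0) = 0 /\ v (idx_a 1) = 0 /\ v (idx_a 2) = 0 by [].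
have [b0 [b1 b2]] : v (idx_b 0) = 1 /\ v (idx_b 1) = 0 /\ v (idx_b 2) = 0 by [].
have [d0 [d1 d2]] : v (idx_d 0) = 1 /\ v (idx_d 1) = 0 /\ v (idx_d 2) = 0 by [].
suff vX02 : meval v (X02 R) = 4.
  by apply/eqP => X0; move/eqP: vX02; rewrite X0 meval0 eq_sym pnatr_eq0.
move: a0 a1 a2 b0 b1 b2 c0 c1 c2 d0 d1 d2; rewrite -!(mevalXU v) /X02.
(* The definition of [v] is forgotten: only its twelve values enter the computation. *)
move: v => v a0 a1 a2 b0 b1 b2 c0 c1 c2 d0 d1 d2.
ring: a0 a1 a2 b0 b1 b2 c0 c1 c2 d0 d1 d2.
Qed.

(* The only monomial of X32 in the variables a_1, b_0 is 8 a_1 b_0. *)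
Lemma X32_neq0 : X32 R != 0.
Proof.
pose v l : R := (l \in [:: idx_a 1; idx_b 0])%:R.
have [c0 [c1 c2]] : v (idx_c 0) = 0 /\ v (idx_c 1) = 0 /\ v (idx_c 2) = 0 by [].
have [a0 [a1 a2]] : v (idx_a 0) = 0 /\ v (idx_a 1) = 1 /\ v (idx_a 2) = 0 by [].
have [b0 [b1 b2]] : v (idx_b 0) = 1 /\ v (idx_b 1) = 0 /\ v (idx_b 2) = 0 by [].
have [d0 [d1 d2]] : v (idx_d 0) = 0 /\ v (idx_d 1) = 0 /\ v (idx_d 2) = 0 by [].
suff vX32 : meval v (X32 R) = 8.
  by apply/eqP => X0; move/eqP: vX32; rewrite X0 meval0 eq_sym pnatr_eq0.
move: a0 a1 a2 b0 b1 b2 c0 c1 c2 d0 d1 d2; rewrite -!(mevalXU v) /X32.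
move: v => v a0 a1 a2 b0 b1 b2 c0 c1 c2 d0 d1 d2.
ring: a0 a1 a2 b0 b1 b2 c0 c1 c2 d0 d1 d2.
Qed.

Lemma X_2_neq0 (i : 'I_4) : X R i 2 != 0.
Proof.
case: i => [[|[|[|[|//]]]] lti]; rewrite /X /=.
- exact: X02_neq0.
- exact/msym_neq0/X02_neq0.
- exact/msym_neq0/X02_neq0.
- exact: X32_neq0.
Qed.

End Nonzero.

Theorem theorem5p1 (R : realType) :
  exists Q : 'I_4 -> {poly {mpoly R[3 + 3 + (3 + 3)]}},
    (forall i : 'I_4,
        size (Q i) = 3%N /\
        Q i = X R i 2 *: 'X^2 + X R i 1 *: 'X + (X R i 0)%:P) /\
    forall (c a b d : 'rV[R]_3) (z : 'rV[R]_4),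
      (forall i j k : 'I_3,
          j = i + 1 %[mod 3] -> k = j + 1 %[mod 3] ->
          let z' (l : 'I_3) := z 0 (widen_ord (leqnSn 3) l) in
          a 0 i = b 0 j * z' j ^+ 2 + b 0 k * z' k ^+ 2
                  - 2 * d 0 i * z' j * z' k
          /\ c 0 i = z 0 ord_max ^+ 2 + b 0 i * z' i ^+ 2
                  - 2 * z' i * z 0 ord_max) ->
      forall i : 'I_4,
        (map_poly (meval (row_mx (row_mx c a) (row_mx b d) 0)) (Q i)).[z 0 i ^+ 2]
        = 0.
Proof.
exists (fun i => X R i 2 *: 'X^2 + X R i 1 *: 'X + (X R i 0)%:P); split.
  by move=> i; rewrite size_quadratic ?X_2_neq0.
move=> c a b d z zP i.
set v : 'I_(3 + 3 + (3 + 3)) -> R := row_mx (row_mx c a) (row_mx b d) 0.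
pose y l := z 0 (widen_ord (leqnSn 3) l); pose t := z 0 ord_max.
have vyt : compatible _ v y t.
  move=> j k l jkl.
  rewrite /v !(row_mxEl, row_mxEr).
  (* Three distinct indices are in cyclic order, possibly after exchanging the last two. *)
  have [jk|kj] : (k = j + 1 %[mod 3] /\ l = k + 1 %[mod 3])
      \/ (l = j + 1 %[mod 3] /\ k = l + 1 %[mod 3]).
  - by case: j k l jkl => [[|[|[|//]]] ?] [[|[|[|//]]] ?] [[|[|[|//]]] ?] // _;
      [left|right|right|left|left|right].
  - exact: zP jk.1 jk.2.
  - have [-> ->] := zP _ _ _ kj.1 kj.2; split=> //.
    rewrite /y; ring.
rewrite !rmorphD /= !map_polyZ map_polyXn map_polyX map_polyC !hornerE hornerXn.
case: i => [[|[|[|[|//]]]] lti]; rewrite /X /= ?meval_msym.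
- have -> : Ordinal lti = widen_ord (leqnSn 3) 0 by exact: val_inj.
  exact: quadratic0_eq0 _ _ _ _ vyt.
(* Thus [z_1] is the coordinate of index 0 of the swapped point. *)
- have -> : Ordinal lti = widen_ord (leqnSn 3) (tperm 0 1 0).
    by apply: val_inj; rewrite tpermL.
  exact: quadratic0_eq0 _ _ _ _ (compatible_swap _ 0 1 _ _ _ vyt).
- have -> : Ordinal lti = widen_ord (leqnSn 3) (tperm 0 2 0).
    by apply: val_inj; rewrite tpermL.
  exact: quadratic0_eq0 _ _ _ _ (compatible_swap _ 0 2 _ _ _ vyt).
- have -> : Ordinal lti = ord_max by exact: val_inj.
  exact: quadratic3_eq0 _ _ _ _ vyt.
Qed.
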